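(* As $n\to\infty$, $$n^{-\beta}\cdot\sup_{(a,b,c,d)\in I}\Big\{O_n(a,b,c,d)-n(b-a)(d-c)\Big\}\longrightarrow \sup_{(a,b,c,d)\in I}\mathcal F(a,b,c,d)$$ in probability and with convergence of all moments (i.e. the $p$th absolute moment of the difference of the two sides tends to $0$ for every $p>0$).
   Context: Let $(X_i)_{i\ge1}$ be i.i.d. random points with the uniform distribution on $[0,1]^2$. For $p=(t,s)\in[0,1]^2$ put $\mathrm{SW}(p)=[0,t]\times[0,s]$, $\mathrm{NW}(p)=[0,t]\times(s,1]$, $\mathrm{SE}(p)=(t,1]\times[0,s]$, $\mathrm{NE}(p)=(t,1]\times(s,1]$. Random quadtree and its partitions: start with the partition $\{[0,1]^2\}$ of the unit square. For $i=1,2,\dots$ let $\mathcal R_i$ be the unique rectangle of the current partition containing $X_i$, and replace $\mathcal R_i$ in the partition by the four rectangles $\mathcal R_i\cap\mathrm{SW}(X_i)$, $\mathcal R_i\cap\mathrm{NW}(X_i)$, $\mathcal R_i\cap\mathrm{SE}(X_i)$, $\mathcal R_i\cap\mathrm{NE}(X_i)$. The quadtree $T_n$ has nodes storing $X_1,\dots,X_n$. Let $I=\{(a,b,c,d)\in[0,1]^4: a\le b,\ c\le d\}$ and $\mathrm{Vol}(a,b,c,d)=(b-a)(d-c)$. The cost $O_n(a,b,c,d)$ of the orthogonal range query with rectangle with corners $(a,c)$ and $(b,d)$ is the number of nodes of $T_n$ visited by the query: if $a,b$ differ from all first coordinates and $c,d$ differ from all second coordinates of the $X_i$, then $O_n(a,b,c,d)=\#\{1\le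 i\le n:\mathcal R_i\cap([a,b]\times[c,d])\ne\emptyset\}$ (for $a<b$, $c<d$ this equals $\#\{1\le i\le n:\mathcal R_i\cap((a,b]\times(c,d])\neq\emptyset\}$); for the remaining $(a,b,c,d)\in I$, $O_n$ is extended by right-continuity in all coordinates. $\beta=\frac{\sqrt{17}-3}{2}$, and $\|f\|=\sup_{(a,b,c,d)\in I}|f(a,b,c,d)|$. $\mathcal F$ denotes the (almost surely unique) random continuous function on $I$ with $\|n^{-\beta}(O_n-n\,\mathrm{Vol})-\mathcal F\|\to0$ in probability and with convergence of all moments; the existence of $\mathcal F$ is a theorem of the same paper and may be taken as known. *)

(* Defs.v *)
From HB Require Import structures.
From mathcomp Require Import all_boot all_order all_algebra.
From mathcomp Require Import all_classical all_reals all_analysis.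
Import Order.TTheory GRing.Theory Num.Theory.
Import numFieldNormedType.Exports.

Set Implicit Arguments.
Unset Strict Implicit.
Unset Printing Implicit Defensive.

Local Open Scope classical_set_scope.
Local Open Scope ring_scope.

Section quadtree.
Context {R : realType}.
Implicit Types (p : R * R) (x : nat -> R * R) (q : R * R * R * R).

Definition unit_square : set (R * R) := `[0, 1] `*` `[0, 1].

Definition SW p : set (R * R) := `[0, p.1] `*` `[0, p.2].
Definition NW p : set (R * R) := `[0, p.1] `*` `]p.2, 1].
Definition SE p : set (R * R) := `]p.1, 1] `*` `[0, p.2].
Definition NE p : set (R * R) := `]p.1, 1] `*` `]p.2, 1].

(* The block of the partition [Pi] containing [p]; it is unique when [Pi] is a
   partition of the unit square and [p] lies in the unit square. *)
Definition block (Pi : set (set (R * R))) p : set (R * R) :=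
  xget set0 [set r | Pi r /\ r p].

(* Points are numbered from 0: [x i] is the (i+1)-st inserted point, and
   [quadtree_partition x n] is the partition after inserting x 0, ..., x n.-1. *)
Fixpoint quadtree_partition x (n : nat) : set (set (R * R)) :=
  match n with
  | 0%N => [set unit_square]
  | m.+1 =>
      let Q := block (quadtree_partition x m) (x m) in
      (quadtree_partition x m `\ Q) `|`
      [set Q `&` SW (x m); Q `&` NW (x m); Q `&` SE (x m); Q `&` NE (x m)]
  end.

Definition region x (i : nat) : set (R * R) :=
  block (quadtree_partition x i) (x i).

Definition query_domain : set (R * R * R * R) :=
  [set q | let: (a, b, c, d) := q in
           [/\ 0 <= a, a <= b, b <= 1, 0 <= c & c <= d <= 1]].

Definition vol q : R := let: (a, b, c, d) := q in (b - a) * (d - c).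

Definition query_rect q : set (R * R) :=
  let: (a, b, c, d) := q in `[a, b] `*` `[c, d].

Definition generic x (n : nat) q : Prop :=
  let: (a, b, c, d) := q in
  forall i, (i < n)%N ->
    [/\ a != (x i).1, b != (x i).1, c != (x i).2 & d != (x i).2].

Definition visited x (n : nat) q : R :=
  #|[set i : 'I_n | `[< region x i `&` query_rect q !=set0 >]]|%:R.

Definition generic_above x (n : nat) q : set (R * R * R * R) :=
  let: (a, b, c, d) := q in
  [set q' | let: (a', b', c', d') := q' in
            [/\ query_domain q', generic x n q' &
                [/\ a <= a', b <= b', c <= c' & d <= d']]].

(* The cost O_n. At a non-generic query it is the limit of [visited] along
   generic queries of the domain approaching from the right in all four
   coordinates. *)
Definition cost x (n : nat) q : R :=
  if `[< generic x n q >] then visited x n q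
  else lim (visited x n q' @[q' --> within (generic_above x n q) (nbhs q)]).

Definition beta : R := (Num.sqrt 17 - 3) / 2.

Definition sup_norm (f : R * R * R * R -> R) : R :=
  sup [set `|f q| | q in query_domain].

End quadtree.

Section probability.
Context {R : realType} {d : measure_display} {Omega : measurableType d}.
Variable P : probability Omega R.

Definition mutually_independent {d' : measure_display} {E : measurableType d'}
    (X : nat -> {RV P >-> E}) : Prop :=
  forall (s : seq nat) (A : nat -> set E),
    uniq s -> (forall i, i \in s -> measurable (A i)) ->
    P (\bigcap_(i in [set` s]) (X i @^-1` A i)) =
    (\prod_(i <- s) P (X i @^-1` A i))%E.

Definition uniform_on_square (Y : {RV P >-> (R * R)%type}) : Prop :=
  forall A : set (R * R), measurable A ->
    distribution P Y A =
    (@lebesgue_measure R \x @lebesgue_measure R)%E (A `&` unit_square).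

(* Convergence in probability together with convergence of all moments. The
   processes below are suprema over an uncountable set, of paths that are only
   almost surely regular, so their measurability is not built into the types.
   Hence the outer measure [mu_ext P], which equals [P] on measurable sets (and
   the completion of [P] on sets that are measurable up to a null set). *)
Definition cvg_prob_moments (Y : nat -> Omega -> R) (Z : Omega -> R) : Prop :=
  (forall e : R, 0 < e ->
     mu_ext P [set w | e <= `|Y n w - Z w|] @[n --> \oo] --> 0%E) /\
  (forall p : R, 0 < p ->
     'E_P[fun w => (`|Y n w - Z w| `^ p)%R]%E @[n --> \oo] --> 0%E).

(* A random element of the space of continuous functions on the domain. *)
Definition random_continuous (F : Omega -> R * R * R * R -> R) : Prop :=
  (forall q, query_domain q -> measurable_fun [set: Omega] (F ^~ q)) /\
  (forall w, {within query_domain, continuous (F w)}).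

End probability.

(* Main.v *)
(* For every outcome, [|c sup f - sup g| <= sup |c f - g|] when [c >= 0] and [f],
   [g] are bounded, so both modes of convergence follow by domination from those
   of the sup norm. Boundedness matters because [sup] is 0 on unbounded sets:
   the limit is bounded since it is continuous on a compact domain, the cost
   since it is at most [n], up to the arbitrary values that [lim] takes on
   divergent or improper filters. *)

Require Import Defs.
From mathcomp Require Import all_boot all_order all_algebra.
From mathcomp Require Import all_classical all_reals all_analysis.
Import Order.TTheory GRing.Theory Num.Theory.
Import numFieldNormedType.Exports.
Local Open Scope classical_set_scope.
Local Open Scope ring_scope.

(* If [u @ F] does not converge, its [lim] is the default point; if [F] contains
   the empty set, its [lim] is the choice element of [setT]. Neither depends on
   [F]. *)
Lemma lim_uniformly_bounded {R : realType} {T : Type} {u : T -> R} {M : R} :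
  (forall t, `|u t| <= M) ->
  exists K : R, forall F : set_system T, Filter F -> `|lim (u @ F)| <= K.
Proof.
move=> uM; exists (`|M| + `|get [set: R]| + `|point : R|) => F FF.
have [F0|F0] := pselect (F set0).
  have -> : lim (u @ F) = get [set: R].
    rewrite /lim /lim_in; congr get; apply/seteqP; split=> // l _ A _.
    exact: (filterS (@sub0set _ _) F0).
  by rewrite addrAC lerDr addr_ge0.
have [ucv|udv] := pselect (cvg (u @ F)); last first.
  have -> : lim (u @ F) = point.
    by apply: xgetPN => l ul; apply: udv; apply/cvg_ex; exists l.
  by rewrite lerDr addr_ge0.
have PF : ProperFilter F by split.
have uM' : `|lim (u @ F)| <= M.
  rewrite ler_norml; apply/andP; split.
    apply: limr_ge => //; apply: nearW => t.
    by move: (uM t); rewrite ler_norml => /andP[].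
  apply: limr_le => //; apply: nearW => t.
  exact: le_trans (ler_norm _) (uM t).
by rewrite -addrA (le_trans uM')// (le_trans (ler_norm M))// lerDl addr_ge0.
Qed.

(** The bound may depend on [x] and [n]: it only serves, for a fixed outcome, to make the suprema
    genuine least upper bounds. *)
Lemma cost_bounded {R : realType} (x : nat -> R * R) (n : nat) :
  exists K, forall q, `|cost x n q| <= K.
Proof.
have vn q : `|visited x n q| <= n%:R.
  by rewrite normr_nat ler_nat -[leqRHS]card_ord max_card.
have [K limK] := lim_uniformly_bounded vn.
exists (n%:R + `|K|) => q; rewrite /cost; case: ifPn => _.
  by rewrite (le_trans (vn q))// lerDl.
by rewrite (le_trans (limK _ _))// (le_trans (ler_norm K))// lerDr.
Qed.

Lemma normr_vol_le1 {R : realType} {q : R * R * R * R} :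
  query_domain q -> `|vol q| <= 1.
Proof.
case: q => [[[a b] c] d] /= [a0 ab b1 c0 /andP[cd d1]].
rewrite ger0_norm ?mulr_ge0 ?subr_ge0//.
by rewrite mulr_ile1 ?subr_ge0// lerBlDr (le_trans b1, le_trans d1)// lerDl.
Qed.

(** A closed subset of the compact cube $[0,1]^4$, closed because it is cut out by six non-strict
    inequalities between continuous functions. *)
Lemma compact_query_domain {R : realType} : compact (@query_domain R).
Proof.
pose K := `[0, 1]%classic : set R.
have cK : compact K by exact: segment_compact.
apply: (subclosed_compact _
  (compact_setX (compact_setX (compact_setX cK cK) cK) cK)); last first.
  move=> [[[a b] c] d] [a0 ab b1 c0 /andP[cd d1]]; rewrite /K /= !in_itv /=.
  rewrite a0 b1 c0 d1 (le_trans ab b1) (le_trans a0 ab) (le_trans c0 cd).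
  by rewrite (le_trans cd d1).
have closed_le_fun (f g : R * R * R * R -> R) :
    continuous f -> continuous g -> closed [set q | f q <= g q].
  move=> cf cg; rewrite (_ : mkset _ = (g \- f) @^-1` [set y | 0 <= y]).
    apply: closed_comp; last exact: closed_ge.
    by move=> q _; apply: continuousB; [exact: cg|exact: cf].
  by apply/seteqP; split=> q /=; rewrite subr_ge0.
pose a (q : R * R * R * R) := q.1.1.1; pose b (q : R * R * R * R) := q.1.1.2.
pose c (q : R * R * R * R) := q.1.2; pose e (q : R * R * R * R) := q.2.
have cfst (T U : topologicalType) : continuous (@fst T U).
  by move=> p; exact: cvg_fst.
have csnd (T U : topologicalType) : continuous (@snd T U).
  by move=> p; exact: cvg_snd.
have cff (T U V : topologicalType) : continuous (fun q : T * U * V => q.1.1).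
  by move=> q; exact: (continuous_comp (cfst _ _ q) (cfst _ _ q.1)).
have ca : continuous a.
  by move=> q; exact: (continuous_comp (cff _ _ _ q) (cfst _ _ q.1.1)).
have cb : continuous b.
  by move=> q; exact: (continuous_comp (cff _ _ _ q) (csnd _ _ q.1.1)).
have cc : continuous c.
  by move=> q; exact: (continuous_comp (cfst _ _ q) (csnd _ _ q.1)).
have ce : continuous e by exact: csnd.
have c0 : continuous (fun _ : R * R * R * R => 0 : R) by exact: cst_continuous.
have c1 : continuous (fun _ : R * R * R * R => 1 : R) by exact: cst_continuous.
rewrite (_ : query_domain =
  [set q | 0 <= a q] `&` [set q | a q <= b q] `&` [set q | b q <= 1] `&`
  [set q | 0 <= c q] `&` [set q | c q <= e q] `&` [set q | e q <= 1]).
  by do !apply: closedI; exact: closed_le_fun.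
apply/seteqP; split=> -[[[? ?] ?] ?]; rewrite /a /b /c /e /=.
  by move=> [? ? ? ? /andP[]].
by move=> [[[[[? ?] ?] ?] ?] ?]; split=> //; apply/andP.
Qed.

Lemma within_query_domain_bounded {R : realType} {f : R * R * R * R -> R} :
  {within query_domain, continuous f} ->
  exists K, forall q, query_domain q -> `|f q| <= K.
Proof.
move=> cf.
have [K [_ fK]] :=
  compact_bounded (continuous_compact cf compact_query_domain).
(* [compact_bounded] only provides the bounds strictly above [K]. *)
exists (K + 1) => q Dq; apply: (fK (K + 1)); first by rewrite ltrDl.
by exists q.
Qed.

(** With [S] the right-hand side, pointwise $cf \le g + S$ and $g \le cf + S$; taking suprema over
    [D] gives the two halves. [Kf] and [Kg] also bound the set behind [S], by [c * Kf + Kg]. *)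
Lemma ler_dist_sup {R : realType} {T : Type} {D : set T} {f g : T -> R}
    {c Kf Kg : R} : 0 <= c -> D !=set0 ->
    (forall q, D q -> `|f q| <= Kf) -> (forall q, D q -> `|g q| <= Kg) ->
  `|c * sup [set f q | q in D] - sup [set g q | q in D]| <=
    sup [set `|c * f q - g q| | q in D].
Proof.
move=> c0 [q0 Dq0] fK gK.
set S := sup [set `|_| | _ in _].
have leS q : D q -> `|c * f q - g q| <= S.
  move=> Dq; apply: ub_le_sup; last by exists q.
  exists (c * Kf + Kg) => _ [t Dt <-].
  rewrite (le_trans (ler_normB _ _))// lerD ?gK// normrM ger0_norm//.
  by rewrite ler_wpM2l ?fK.
have lef q : D q -> f q <= sup [set f q | q in D].
  move=> Dq; apply: ub_le_sup; last by exists q.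
  by exists Kf => _ [t Dt <-]; rewrite (le_trans (ler_norm _))// fK.
have leg q : D q -> g q <= sup [set g q | q in D].
  move=> Dq; apply: ub_le_sup; last by exists q.
  by exists Kg => _ [t Dt <-]; rewrite (le_trans (ler_norm _))// gK.
have lecf q : D q -> c * f q <= sup [set g q | q in D] + S.
  move=> Dq; rewrite -lerBlDl (le_trans _ (leS _ Dq))//.
  by rewrite (le_trans _ (ler_norm _))// lerB// leg.
rewrite ler_distl; apply/andP; split; last first.
  (* For positive [c], dividing by [c] reduces the claim to a bound on [f] alone. The case [c = 0]
     does occur below, at [n = 0], where the power of zero is zero; there [lecf] at [q0] is already
     the claim. *)
  move: c0; rewrite le_eqVlt => /predU1P[c0|c0].
    by have := lecf _ Dq0; rewrite -c0 !mul0r.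
  rewrite mulrC -ler_pdivlMr//; apply: ge_sup; first by exists (f q0), q0.
  by move=> _ [q Dq <-]; rewrite ler_pdivlMr// mulrC lecf.
rewrite lerBlDr; apply: ge_sup; first by exists (g q0), q0.
move=> _ [q Dq <-].
have := leS _ Dq; rewrite ler_distlC => /andP[_ /le_trans]; apply.
by rewrite lerD2r ler_wpM2l// lef.
Qed.

(* The integral of any nonnegative function, measurable or not, is the supremum
   of the integrals of the simple functions below it. *)
Lemma ge0_le_expectation {R : realType} {d : measure_display}
    {T : measurableType d} {P : probability T R} {f g : T -> R} :
  (forall w, 0 <= f w) -> (forall w, f w <= g w) -> ('E_P[f] <= 'E_P[g])%E.
Proof.
move=> f0 fg; rewrite unlock !ge0_integralTE//; last first.
  by move=> w; rewrite lee_fin (le_trans (f0 w)).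
apply: le_ereal_sup => _ [h /= hf <-].
by exists h => //= w; rewrite (le_trans (hf w))// lee_fin.
Qed.

(** Outer measure and the expectation of nonnegative functions are monotone even without
    measurability, so both quantities are squeezed between 0 and their counterparts for [Y'] and
    [Z']. *)
Lemma le_cvg_prob_moments {R : realType} {d : measure_display}
    {T : measurableType d} {P : probability T R}
    {Y Y' : nat -> T -> R} {Z Z' : T -> R} :
  (forall n w, `|Y n w - Z w| <= `|Y' n w - Z' w|) ->
  cvg_prob_moments P Y' Z' -> cvg_prob_moments P Y Z.
Proof.
move=> YY' [Y'pr Y'mo]; split=> [e e0|p p0].
  apply: (squeeze_cvge _ (cvg_cst 0%E) (Y'pr _ e0)); apply: nearW => n.
  rewrite mu_ext_ge0//=; apply: le_mu_ext => w /= /le_trans; apply.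
  exact: YY'.
apply: (squeeze_cvge _ (cvg_cst 0%E) (Y'mo _ p0)); apply: nearW => n.
apply/andP; split.
  by rewrite unlock; apply: integral_ge0 => w _; rewrite lee_fin powR_ge0.
apply: ge0_le_expectation => w; first exact: powR_ge0.
by rewrite ge0_ler_powR ?nnegrE ?(ltW p0).
Qed.

Theorem corollary1p2 (R : realType) (d : measure_display)
    (Omega : measurableType d) (P : probability Omega R)
    (X : nat -> {RV P >-> (R * R)%type})
    (X_uniform : forall i, uniform_on_square (X i))
    (X_independent : mutually_independent X)
    (F : Omega -> R * R * R * R -> R)
    (F_random_continuous : random_continuous F)
    (F_limit : cvg_prob_moments P
       (fun n w => sup_norm (fun q =>
          n%:R `^ (- beta) * (cost (fun i => X i w) n q - n%:R * vol q)
          - F w q))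
       (fun=> 0)) :
  cvg_prob_moments P
    (fun n w => n%:R `^ (- beta) *
       sup [set cost (fun i => X i w) n q - n%:R * vol q | q in query_domain])
    (fun w => sup [set F w q | q in query_domain]).
Proof.
apply: (le_cvg_prob_moments _ F_limit) => n w; rewrite subr0.
have [Kc costK] := cost_bounded (fun i => X i w) n.
have [KF FK] := within_query_domain_bounded (F_random_continuous.2 w).
have costvolK q : query_domain q ->
    `|cost (fun i => X i w) n q - n%:R * vol q| <= Kc + n%:R.
  move=> Dq; rewrite (le_trans (ler_normB _ _))// lerD ?costK//.
  by rewrite normrM normr_nat ler_piMr// normr_vol_le1.
(* The deviation in [F_limit] is the absolute value of the sup norm, so bounding by the sup norm
   itself suffices. *)
apply: le_trans (ler_norm _).
apply: ler_dist_sup (powR_ge0 _ _) _ costvolK FK.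
by exists (0, 0, 0, 0) => /=; rewrite !lexx ler01.
Qed.
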